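(* Let $f=\sum_{|\alpha|\ge1}a_\alpha X_\alpha$ be a positive regular free holomorphic function and $m\ge1$. If $T=(T_1,\dots,T_n)$ is an $n$-tuple of operators in the noncommutative domain $\mathbf D_f^m(\mathcal H)$ and $$Q_{f,T}:=\text{SOT-}\lim_{k\to\infty}\Phi_{f,T}^k(I),$$ then the space $\mathcal H$ admits an orthogonal decomposition of the form $$\mathcal H=\mathcal M\oplus\ker Q_{f,T}\oplus\ker(I-Q_{f,T}),$$ where the subspaces $\ker Q_{f,T}$ and $\ker(I-Q_{f,T})$ are invariant under each operator $T_i^*$, $i=1,\dots,n$.
   Context: Let $n\in\mathbb N=\{1,2,\dots\}$. $\mathbb F_n^+$ is the unital free semigroup on generators $g_1,\dots,g_n$ with identity $g_0$; $|\alpha|$ is the word length ($|g_0|=0$). For $X=(X_1,\dots,X_n)\in B(\mathcal H)^n$ ($\mathcal H$ a complex Hilbert space) put $X_\alpha=X_{i_1}\cdots X_{i_k}$ if $\alpha=g_{i_1}\cdots g_{i_k}$ and $X_{g_0}=I$. A positive regular free holomorphic function is a formal series $f=\sum_{\alpha\in\mathbb F_n^+}a_\alpha X_\alpha$ in noncommuting variables with $\limsup_{k\to\infty}(\sum_{|\alpha|=k}|a_\alpha|^2)^{1/2k}<\infty$, $a_\alpha\ge 0$ for all $\alpha$, $a_{g_0}=0$, and $a_{g_i}>0$ for $i=1,\dots,n$. Whenever $\sum_{|\alpha|\ge1}a_\alpha X_\alpha X_\alpha^*$ converges in the weak operator topology (WOT), $\Phi_{f,X}(Y)=\sum_{|\alpha|\ge1}a_\alpha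 X_\alpha YX_\alpha^*$ for $Y\in B(\mathcal H)$ (WOT convergence). $id$ is the identity map on $B(\mathcal H)$. $\mathbf D_f^m(\mathcal H)$ is the set of $X\in B(\mathcal H)^n$ (with the series above WOT convergent) such that $(id-\Phi_{f,X})^s(I)\ge 0$ for $s=1,\dots,m$. For $T\in\mathbf D_f^m(\mathcal H)$ one has $\Phi_{f,T}(I)\le I$, so the sequence $\Phi_{f,T}^k(I)$ is decreasing and the strong limit $Q_{f,T}$ exists. *)

(* Defs.v *)
From HB Require Import structures.
From mathcomp Require Import all_boot all_order all_algebra finmap.
From mathcomp Require Import all_classical all_reals all_analysis.
From mathcomp Require Import complex.
From mathcomp.analysis.showcase Require Import summability.

Set Implicit Arguments.
Unset Strict Implicit.
Unset Printing Implicit Defensive.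

Import Order.TTheory GRing.Theory Num.Theory.
Import numFieldNormedType.Exports.

Local Open Scope classical_set_scope.
Local Open Scope complex_scope.
Local Open Scope ring_scope.

(* The inner product is linear in its first argument and conjugate-linear in
   the second one; completeness is inherited from [completeNormedModType]. *)
HB.mixin Record CompleteNormedModule_isHilbert (R : realType) (H : Type)
    & CompleteNormedModule R[i] H := {
  inner : {dot H for @Num.conj R[i]};
  inner_norm : forall u : H, `|u| ^+ 2 = inner u u
}.

#[short(type="hilbertType")]
HB.structure Definition Hilbert (R : realType) :=
  {H of CompleteNormedModule R[i] H & CompleteNormedModule_isHilbert R H}.

Section BoundedOperators.
Variables (R : realType) (H : hilbertType R).

Definition bounded_linear : {pred H -> H} :=
  fun f => `[< linear f /\ continuous f >].

Fact bounded_linear_submod : submod_closed bounded_linear.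
Proof.
split.
  apply/asboolP; split; last by move=> x; exact: cvg_cst.
  by move=> a x y; rewrite /= scaler0 addr0.
move=> a f g /asboolP[lf cf] /asboolP[lg cg]; apply/asboolP; split.
  move=> b x y; change (a *: f (b *: x + y) + g (b *: x + y) =
    b *: (a *: f x + g x) + (a *: f y + g y)).
  by rewrite lf lg !scalerDr !scalerA [(a * b)%R]mulrC addrACA.
move=> x; apply: cvgD; last exact: cg.
by apply: cvgZr; exact: cf.
Qed.

HB.instance Definition _ :=
  GRing.isSubmodClosed.Build R[i] (H -> H) bounded_linear bounded_linear_submod.

Record bounded_operator := BoundedOperator {
  bop_fun :> H -> H;
  bop_funP : bop_fun \in bounded_linear
}.

HB.instance Definition _ := [isSub for bop_fun].
HB.instance Definition _ := [Choice of bounded_operator by <:].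
HB.instance Definition _ :=
  [SubChoice_isSubLmodule of bounded_operator by <:].

Implicit Types A B : bounded_operator.

Fact bop_linear A : linear A.
Proof. by have /asboolP[] := bop_funP A. Qed.

Fact bop_continuous A : continuous A.
Proof. by have /asboolP[] := bop_funP A. Qed.

HB.instance Definition _ A := GRing.isLinear.Build R[i] H H _ A (bop_linear A).

Fact bop_one_subproof : (id : H -> H) \in bounded_linear.
Proof. by apply/asboolP; split=> // x; exact: cvg_id. Qed.

Definition bop_one := BoundedOperator bop_one_subproof.

Fact bop_comp_subproof A B : (A \o B) \in bounded_linear.
Proof.
apply/asboolP; split; first by move=> a x y; rewrite /= !linearP.
by move=> x; apply: continuous_comp; exact: bop_continuous.
Qed.

Definition bop_comp A B := BoundedOperator (bop_comp_subproof A B).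

Fact bop_compA : associative bop_comp.
Proof. by move=> A B D; exact: val_inj. Qed.
Fact bop_comp1l : left_id bop_one bop_comp.
Proof. by move=> A; exact: val_inj. Qed.
Fact bop_comp1r : right_id bop_one bop_comp.
Proof. by move=> A; exact: val_inj. Qed.
Fact bop_compDl : left_distributive bop_comp +%R.
Proof. by move=> A B D; exact: val_inj. Qed.
Fact bop_compDr : right_distributive bop_comp +%R.
Proof.
by move=> A B D; apply: val_inj; apply/funext => x; exact: raddfD.
Qed.

(* The product of [bounded_operator H] is composition. Only a [pzRingType] is
   available: 1 = 0 when [H] is the zero space. *)
HB.instance Definition _ := GRing.Zmodule_isPzRing.Build bounded_operator
  bop_compA bop_comp1l bop_comp1r bop_compDl bop_compDr.

End BoundedOperators.

Notation "''B' ( H )" := (bounded_operator H)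
  (at level 0, format "''B' ( H )") : type_scope.

Section OperatorTheory.
Variables (R : realType) (H : hilbertType R).
Implicit Types (A B Z : 'B(H)) (V : set H).

Definition positive_operator A := forall x : H, 0 <= inner (A x) x.

(* By the Riesz theorem the set below is a singleton. *)
Definition adjoint A : 'B(H) :=
  xget 0 [set B : 'B(H) | forall x y : H, inner (A x) y = inner x (B y)].

(* [R[i]^o] carries the norm topology of the complex plane. *)
Definition WOT_cvg {I : Type} (F : set_system I) (u : I -> 'B(H)) Z :=
  forall x y : H,
    (inner (u i x) y : R[i]^o) @[i --> F] --> (inner (Z x) y : R[i]^o).

Definition SOT_cvg {I : Type} (F : set_system I) (u : I -> 'B(H)) Z :=
  forall x : H, u i x @[i --> F] --> Z x.

(* SOT limits are unique; the default 0 is only used when there is none. *)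
Definition SOT_lim (u : nat -> 'B(H)) : 'B(H) :=
  xget 0 [set Z : 'B(H) | SOT_cvg \oo u Z].

Definition ker A : set H := [set x | A x = 0].

Definition closed_subspace V :=
  [/\ V 0, forall (a : R[i]) x y, V x -> V y -> V (a *: x + y) & closed V].

Definition orthogonal_spaces (U V : set H) :=
  forall x y, U x -> V y -> inner x y = 0.

Definition orthogonal_decomposition3 (U V W : set H) :=
  [/\ [/\ closed_subspace U, closed_subspace V & closed_subspace W],
      [/\ orthogonal_spaces U V, orthogonal_spaces U W
        & orthogonal_spaces V W]
    & forall x, exists u v w, [/\ U u, V v, W w & x = u + v + w]].

Definition invariant_under V A := forall x, V x -> V (A x).

End OperatorTheory.

(* [seq 'I_n] is the free semigroup on n generators: the empty word is g_0 and
   the length of a word is its [size]. *)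
Record positive_regular (R : realType) (n : nat) (a : seq 'I_n -> R) : Prop := {
  posreg_limsup :
    (limn_esup (fun k : nat =>
       ((\sum_(w : k.-tuple 'I_n) `|a w| ^+ 2) `^ ((2 * k)%:R^-1))%:E)
     < +oo)%E;
  posreg_ge0 : forall w, 0 <= a w;
  posreg_nil : a [::] = 0;
  posreg_gen : forall i : 'I_n, 0 < a [:: i]
}.

Section NoncommutativeDomain.
Variables (R : realType) (H : hilbertType R) (n : nat).
Implicit Types (a : seq 'I_n -> R) (X : 'I_n -> 'B(H)) (Y Z : 'B(H)).

Definition word_op X (w : seq 'I_n) : 'B(H) := \prod_(i <- w) X i.

Definition Phi_partial a X Y (F : {fset seq 'I_n}) : 'B(H) :=
  \sum_(w <- F | (0 < size w)%N)
     (a w)%:C *: (word_op X w * Y * adjoint (word_op X w)).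

(* The sum over words is the limit, in WOT, along the net of finite sets of
   words. *)
Definition Phi_cvg a X Y Z := WOT_cvg totally (Phi_partial a X Y) Z.

(* WOT limits are unique; when [Phi_cvg a X 1] holds for some limit, the series
   converges for every [Y], so the default 0 is never reached on [ncdomain]. *)
Definition Phi a X Y : 'B(H) := xget 0 [set Z | Phi_cvg a X Y Z].

Definition ncdomain a (m : nat) : set ('I_n -> 'B(H)) :=
  [set X | (exists Z, Phi_cvg a X 1 Z) /\
     forall s : nat, (1 <= s <= m)%N ->
       positive_operator (iter s (fun Y => Y - Phi a X Y) 1)].

Definition Qlim a X : 'B(H) := SOT_lim (fun k => iter k (Phi a X) 1).

End NoncommutativeDomain.

(* Main.v *)
Require Import Defs.
From mathcomp Require Import all_boot all_order all_algebra finmap.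
From mathcomp Require Import all_classical all_reals all_analysis.
From mathcomp Require Import complex ring.
From mathcomp.analysis.showcase Require Import summability.

(** Write [Q_k = Phi^k(1)]. Since [Phi] preserves order and [Phi(1) <= 1], the
    [Q_k] are positive contractions decreasing strongly to a positive
    contraction [Q].

    Invariance. For a positive contraction [Y], the form of [Phi(Y)] at [x] is
    the sum over words [w] of [a_w <Y T_w^* x, T_w^* x>], a sum of nonnegative
    terms, and the word [g_i] alone contributes [a_i <Y T_i^* x, T_i^* x>].
    Taking [Y = Q_k] and letting [k] grow gives
    [a_i <Q T_i^* x, T_i^* x> <= <Q x, x>]  ([Qlim_gen_le]); taking [Y = 1 - Q_k]
    and using [Phi(1) <= 1] gives the same inequality for [1 - Q]
    ([Qlim_compl_gen_le]). As [a_i > 0], and as a positive contraction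
    kills every vector at which its form vanishes, [T_i^*] preserves both
    kernels.

    Decomposition. This is a fact about a single positive contraction [Q]
    ([effect_decomposition]): the two kernels are eigenspaces of a self-adjoint
    operator for distinct eigenvalues, hence orthogonal. The projection onto the
    eigenspace for the eigenvalue [1] is the strong limit of the powers
    [Q^(2^k)] ([fixed_projection]), the other one is obtained from [1 - Q].

    All existence statements (the values of [Phi], the limit [Q], the
    projections) come from one monotone convergence theorem for nets of positive
    contractions ([increasing_SOT]), which rests on [|A x|^2 <= <A x, x>]
    ([effect_norm]). *)

Set Implicit Arguments.
Unset Strict Implicit.
Unset Printing Implicit Defensive.

Import Order.TTheory GRing.Theory Num.Theory.
Import numFieldNormedType.Exports.

Local Open Scope classical_set_scope.
Local Open Scope complex_scope.
Local Open Scope ring_scope.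

(** * Inner products and positive operators *)

Definition ope_le (R : realType) (H : hilbertType R) (A B : 'B(H)) :=
  positive_operator (B - A).
Local Notation "A <=o B" := (ope_le A B) (at level 70).

Section Operators.
Context {R : realType} {H : hilbertType R}.
Implicit Types (A B Y Z : 'B(H)) (x y z : H).

Lemma innerDl x y z : inner (x + y) z = inner x z + inner y z.
Proof. exact: linearDl. Qed.
Lemma innerDr x y z : inner x (y + z) = inner x y + inner x z.
Proof. exact: linearDr. Qed.
Lemma innerNl x y : inner (- x) y = - inner x y.
Proof. exact: linearNl. Qed.
Lemma innerNr x y : inner x (- y) = - inner x y.
Proof. exact: linearNr. Qed.
Lemma innerZl (c : R[i]) x y : inner (c *: x) y = c * inner x y.
Proof. exact: linearZl_LR. Qed.
Lemma innerZr (c : R[i]) x y : inner x (c *: y) = Num.conj c * inner x y.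
Proof. exact: linearZr_LR. Qed.

Lemma innerC x y : inner x y = Num.conj (inner y x).
Proof. by rewrite hermC /= expr0 mul1r. Qed.

Lemma opeD A x y : A (x + y) = A x + A y.
Proof. exact: linearD. Qed.
Lemma opeN A x : A (- x) = - A x.
Proof. exact: linearN. Qed.
Lemma opeZ A (c : R[i]) x : A (c *: x) = c *: A x.
Proof. exact: linearZ. Qed.

Lemma opeC A x : (1 - A) x = x - A x.
Proof. by []. Qed.

Lemma ii : ('i : R[i]) * 'i = -1.
Proof. by rewrite -expr2 sqr_i. Qed.

Lemma conji : Num.conj ('i : R[i]) = - 'i.
Proof. by apply/eqP; rewrite eq_complex /= oppr0 !eqxx. Qed.

(** Expressing the form of [A] through its diagonal values is what turns
    positivity of [A] into self-adjointness, and, for [A = 1], what makes the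
    inner product continuous because the norm is. *)
Lemma polarization A x y :
  4 * inner (A x) y =
  inner (A (x + y)) (x + y) - inner (A (x - y)) (x - y)
  + 'i * (inner (A (x + 'i *: y)) (x + 'i *: y)
          - inner (A (x - 'i *: y)) (x - 'i *: y)).
Proof.
rewrite !(opeD, opeN, opeZ).
rewrite !(innerDl, innerDr, innerNl, innerNr, innerZl, innerZr) conji.
transitivity ((2 - 2 * ('i * 'i)) * inner (A x) y
              + (2 + 2 * ('i * 'i)) * inner (A y) x).
  by rewrite ii; ring.
ring.
Qed.

(** A positive operator on a complex space is self-adjoint: the diagonal
    values are real, hence so are those occurring in the polarization identity,
    and exchanging [x] with [y] conjugates the identity. *)
Lemma positive_sym A : positive_operator A ->
  forall x y, inner (A x) y = inner x (A y).
Proof.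
move=> A0 x y; rewrite (innerC x).
pose cj : {rmorphism R[i] -> R[i]} := Num.conj.
have cji : cj 'i = - 'i by exact: conji.
rewrite -[Num.conj _]/(cj _).
have qC u : cj (inner (A u) u) = inner (A u) u.
  by apply/CrealP; exact: ger0_real.
have n4 : (4 : R[i]) != 0 by rewrite pnatr_eq0.
apply: (mulfI n4).
rewrite -[in RHS](rmorph_nat cj 4) -rmorphM !polarization.
have qi u : inner (A ('i *: u)) ('i *: u) = inner (A u) u.
  by rewrite opeZ innerZl innerZr conji mulrA mulrN ii opprK mul1r.
have qN u : inner (A (- u)) (- u) = inner (A u) u.
  by rewrite opeN innerNl innerNr opprK.
rewrite rmorphD rmorphB rmorphM rmorphB !qC cji.
have -> : y + x = x + y by rewrite addrC.
have -> : y - x = - (x - y) by rewrite opprB.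
have -> : y + 'i *: x = 'i *: (x - 'i *: y).
  by rewrite scalerBr scalerA ii scaleN1r opprK addrC.
have -> : y - 'i *: x = - ('i *: (x + 'i *: y)).
  by rewrite scalerDr scalerA ii scaleN1r opprD opprK addrC.
by rewrite !qN !qi mulNr -mulrN opprB.
Qed.

Lemma ope_leP A B :
  A <=o B <-> forall x, inner (A x) x <= inner (B x) x.
Proof.
by split=> h x; have := h x; rewrite /= innerDl innerNl subr_ge0.
Qed.

Lemma ope_leW A B x : A <=o B -> inner (A x) x <= inner (B x) x.
Proof. by move=> /ope_leP. Qed.

Lemma ope_le_refl A : A <=o A.
Proof. exact/ope_leP. Qed.

Lemma ope_le_trans B A D : A <=o B -> B <=o D -> A <=o D.
Proof.
by move=> AB BD; apply/ope_leP => x; exact: le_trans (ope_leW _ AB) (ope_leW _ BD).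
Qed.

Lemma ope_le_decr (u : nat -> 'B(H)) j k :
  (forall k, u k.+1 <=o u k) -> (k <= j)%N -> u j <=o u k.
Proof.
move=> mu; elim: j => [|j IH].
  by rewrite leqn0 => /eqP ->; exact: ope_le_refl.
rewrite leq_eqVlt => /predU1P[->|/IH]; first exact: ope_le_refl.
exact: ope_le_trans (mu j).
Qed.

Lemma ope_le0 A : 0 <=o A <-> positive_operator A.
Proof. by rewrite /ope_le subr0. Qed.

(** * Positive contractions *)

(** In quantum theory these operators are called effects. *)
Definition effect A := 0 <=o A /\ A <=o 1.

Lemma effect_ge0 A : effect A -> positive_operator A.
Proof. by case=> /ope_le0. Qed.

Lemma effect1 : effect (1 : 'B(H)).
Proof.
split; last exact: ope_le_refl.
by apply/ope_le0 => x /=; rewrite -inner_norm exprn_ge0.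
Qed.

Lemma effect_compl A : effect A -> effect (1 - A).
Proof. by case=> A0 A1; rewrite /effect /ope_le subr0 subKr; split=> //; apply/ope_le0. Qed.

Lemma effect_sub A B : effect A -> effect B -> A <=o B -> effect (B - A).
Proof.
move=> [A0 A1] [B0 B1] AB; split; first exact/ope_le0.
apply/ope_leP => x /=; move/ope_leP/(_ x): B1; apply: le_trans.
by rewrite /= innerDl innerNl gerBl; have /ope_leP/(_ x) := A0; rewrite /= linear0l.
Qed.

(** Positivity of [A] at [x - A x] gives
    [0 <= <Ax,x> - 2 |Ax|^2 + <A(Ax),Ax>], and the last term is at most [|Ax|^2]
    since [A <= 1]. Through this bound the form
    of [A] at [x] controls the vector [A x]. *)
Lemma effect_norm A x : effect A -> `|A x| ^+ 2 <= inner (A x) x.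
Proof.
move=> /[dup] /effect_ge0 A0 [_ /ope_leP/(_ (A x)) /= A1].
rewrite inner_norm -subr_ge0.
have := A0 (x - A x); rewrite !(opeD, opeN, innerDl, innerNl, innerDr, innerNr).
rewrite (positive_sym A0 (A x) x) => h.
move: A1; rewrite -subr_ge0 => /(addr_ge0 h) {}h.
apply: le_trans h _.
by rewrite le_eqVlt; apply/orP; left; apply/eqP; ring.
Qed.

Lemma effect_eq0 A x : effect A -> inner (A x) x = 0 -> A x = 0.
Proof.
move=> eA Ax0; apply/eqP; rewrite -normr_eq0 -sqrf_eq0 eq_le exprn_ge0// andbT.
by rewrite -Ax0 effect_norm.
Qed.

(** Used with [c = a_i] and [y = T_i^* x] for the invariance of the
    kernels. *)
Lemma effect_form_ker A (c : R[i]) x y : effect A -> 0 < c ->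
  c * inner (A y) y <= inner (A x) x -> A x = 0 -> A y = 0.
Proof.
move=> eA c0 + Ax; rewrite Ax linear0l pmulr_rle0// => le0.
by apply: effect_eq0 => //; apply/eqP; rewrite eq_le le0 effect_ge0.
Qed.

Lemma effect_contraction A x : effect A -> `|A x| <= `|x|.
Proof.
move=> /[dup] eA [_ /ope_leP/(_ x) /= A1].
rewrite -(@ler_pXn2r _ 2)// ?nnegrE//.
by apply: le_trans (effect_norm x eA) _; rewrite inner_norm.
Qed.

(** * Limits of operators *)

(** The nonnegative complex numbers are the fixed points of the continuous
    map [z |-> |z|]. *)
Lemma cvg_ge0 {I : Type} (F : set_system I) {FF : ProperFilter F}
    (u : I -> R[i]) (l : R[i]) :
  (u i : R[i]^o) @[i --> F] --> (l : R[i]^o) ->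
  (\forall i \near F, 0 <= u i) -> 0 <= l.
Proof.
move=> ul u0; apply/normr_idP.
pose v i : R[i]^o := u i.
have vl : v @ F --> (`|l| : R[i]^o).
  apply: cvg_trans (cvg_norm ul); apply: near_eq_cvg.
  by near=> i; rewrite ger0_norm//; near: i.
exact: (@norm_cvg_unique _ R[i]^o (v @ F) _ `|l| l vl ul).
Unshelve. all: by end_near. Qed.

Lemma cvg_inner {I : Type} (F : set_system I) {FF : Filter F}
    (u : I -> H) (x y : H) :
  u i @[i --> F] --> x ->
  (inner (u i) y : R[i]^o) @[i --> F] --> (inner x y : R[i]^o).
Proof.
move=> ux.
have n4 : (4 : R[i]) != 0 by rewrite pnatr_eq0.
have E z : inner z y = 4^-1 * (`|z + y| ^+ 2 - `|z - y| ^+ 2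
     + 'i * (`|z + 'i *: y| ^+ 2 - `|z - 'i *: y| ^+ 2)).
  by rewrite !inner_norm -(polarization 1) mulKf.
have N w : (`|u i + w| ^+ 2 : R[i]^o) @[i --> F] --> (`|x + w| ^+ 2 : R[i]^o).
  have nw : (`|u i + w| : R[i]^o) @[i --> F] --> (`|x + w| : R[i]^o).
    by apply: cvg_norm; apply: cvgD ux (cvg_cst _).
  exact: (cvgM nw nw).
rewrite E; under eq_fun do rewrite E.
apply: cvgMl_tmp; apply: cvgD; first by apply: cvgB.
by apply: cvgMl_tmp; apply: cvgB.
Qed.

Lemma SOT_WOT {I : Type} (F : set_system I) {FF : Filter F} (u : I -> 'B(H)) Z :
  SOT_cvg F u Z -> WOT_cvg F u Z.
Proof. by move=> uZ x y; apply: cvg_inner; exact: uZ. Qed.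

Lemma WOT_ope_ge {I : Type} (F : set_system I) {FF : ProperFilter F}
    (u : I -> 'B(H)) A Z :
  WOT_cvg F u Z -> (\forall i \near F, A <=o u i) -> A <=o Z.
Proof.
move=> uZ Au; apply/ope_leP => x; rewrite -subr_ge0.
apply: (@cvg_ge0 _ F _ (fun i => inner (u i x) x - inner (A x) x)).
  by apply: cvgB; [exact: uZ|exact: cvg_cst].
by near=> i; rewrite subr_ge0; move: x; apply/ope_leP; near: i.
Unshelve. all: by end_near. Qed.

Lemma WOT_cvgB {I : Type} (F : set_system I) {FF : Filter F}
    (u v : I -> 'B(H)) A B :
  WOT_cvg F u A -> WOT_cvg F v B -> WOT_cvg F (fun i => u i - v i) (A - B).
Proof.
move=> uA vB x y /=; under eq_fun do rewrite innerDl innerNl.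
by rewrite innerDl innerNl; apply: cvgB; [exact: uA|exact: vB].
Qed.

Lemma WOT_ope_le {I : Type} (F : set_system I) {FF : ProperFilter F}
    (u : I -> 'B(H)) A Z :
  WOT_cvg F u Z -> (\forall i \near F, u i <=o A) -> Z <=o A.
Proof.
move=> uZ uA; apply/ope_leP => x; rewrite -subr_ge0.
apply: (@cvg_ge0 _ F _ (fun i => inner (A x) x - inner (u i x) x)).
  by apply: cvgB; [exact: cvg_cst|exact: uZ].
by near=> i; rewrite subr_ge0; move: x; apply/ope_leP; near: i.
Unshelve. all: by end_near. Qed.

(** The diagonal values [<u_i x, x>] increase to their supremum in the
    reals, and [effect_norm] applied to [u_j - u_i] bounds [|u_j x - u_i x|^2] by
    their increment, so [u_i x] is a Cauchy net. *)
Lemma increasing_cvg {I : Type} (F : set_system I) {FF : ProperFilter F}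
    (u : I -> 'B(H)) x :
  (forall i, effect (u i)) -> (forall i, \forall j \near F, u i <=o u j) ->
  cvg (u i x @[i --> F]).
Proof.
move=> eu mu.
pose q i := complex.Re (inner (u i x) x).
have qE i : inner (u i x) x = (q i)%:C.
  by rewrite RRe_real// ger0_real// effect_ge0.
have supq : has_sup (range q).
  split; first by have [i _] := filter_ex (@filterT _ F _); exists (q i), i.
  exists (complex.Re (inner x x)) => _ [i _ <-].
  have [_ /ope_leP/(_ x)] := eu i.
  by rewrite /= lecE => /andP[].
apply/cauchy_cvgP/cauchyP => e e0.
have eE : e = (complex.Re e)%:C by rewrite RRe_real// gtr0_real.
have re0 : 0 < complex.Re e by move: e0; rewrite eE ltcR.
have [_ [i _ <-] ltqi] := sup_adherent (exprn_gt0 2 re0) supq.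
exists (u i x); change (\forall j \near F, ball (u i x) e (u j x)).
near=> j; rewrite -ball_normE /= distrC.
have uij : u i <=o u j by near: j.
rewrite -(@ltr_pXn2r _ 2)// ?nnegrE ?(ltW e0)//.
have := effect_norm x (effect_sub (eu i) (eu j) uij).
rewrite /= innerDl innerNl !qE => /le_lt_trans; apply.
rewrite eE -rmorphXn -rmorphB ltcR ltrBlDl.
rewrite ltrBlDr in ltqi.
by apply: le_lt_trans ltqi; apply: ub_le_sup; [case: supq|exists j].
Unshelve. all: by end_near. Qed.

(** Vigier's theorem for positive contractions. It is stated for nets
    because [Phi] is a limit along finite sets of words; decreasing sequences are
    reduced to it through complements. *)
Lemma increasing_SOT {I : Type} (F : set_system I) {FF : ProperFilter F}
    (u : I -> 'B(H)) :
  (forall i, effect (u i)) -> (forall i, \forall j \near F, u i <=o u j) ->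
  exists Z, effect Z /\ SOT_cvg F u Z.
Proof.
move=> eu mu.
have cu x : cvg (u i x @[i --> F]) by exact: increasing_cvg.
pose Zf x := lim (u i x @[i --> F]).
have uZ x : u i x @[i --> F] --> Zf x by exact: cu.
have linZ : linear Zf.
  move=> c x y.
  have h : u i (c *: x + y) @[i --> F] --> c *: Zf x + Zf y.
    have -> : (fun i => u i (c *: x + y)) = (fun i => c *: u i x + u i y).
      by apply/funext => i; rewrite opeD opeZ.
    by apply: cvgD (uZ y); apply: cvgZl_tmp.
  exact: norm_cvg_unique (uZ _) h.
have leZ x : `|Zf x| <= `|x|.
  rewrite -subr_ge0; apply: (@cvg_ge0 _ F _ (fun i => `|x| - `|u i x|)).
    by apply: cvgB; [exact: cvg_cst|apply: cvg_norm; exact: uZ].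
  by near=> i; rewrite subr_ge0 effect_contraction.
have bZ : Zf \in bounded_linear (H := H).
  apply/asboolP; split => // x; apply/cvgrPdist_le => e e0; near=> y.
  have -> : Zf x - Zf y = Zf (x - y).
    by rewrite addrC -scaleN1r -linZ scaleN1r addrC.
  apply: le_trans (leZ _) _; near: y.
  by apply: cvgr_dist_le.
have uZ' : SOT_cvg F u (BoundedOperator bZ) by [].
exists (BoundedOperator bZ); split=> //; split.
  by apply: (WOT_ope_ge (SOT_WOT uZ')); near=> i; case: (eu i).
by apply: (WOT_ope_le (SOT_WOT uZ')); near=> i; case: (eu i).
Unshelve. all: by end_near. Qed.

Lemma SOT_form_le (c : R[i]) (u v : nat -> 'B(H)) A B x y :
  SOT_cvg \oo u A -> SOT_cvg \oo v B ->
  (forall k, c * inner (u k y) y <= inner (v k x) x) ->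
  c * inner (A y) y <= inner (B x) x.
Proof.
move=> uA vB le; rewrite -subr_ge0.
apply: (@cvg_ge0 _ \oo _ (fun k => inner (v k x) x - c * inner (u k y) y)).
  apply: cvgB; first by apply: cvg_inner; exact: vB.
  by apply: cvgMl_tmp; apply: cvg_inner; exact: uA.
by apply: nearW => k; rewrite subr_ge0.
Qed.

(** * Monotone sequences and projections onto fixed spaces *)

Lemma ope_le_compl A B : 1 - A <=o 1 - B <-> B <=o A.
Proof. by rewrite /ope_le (_ : 1 - B - (1 - A) = A - B)// opprB addrC addrA subrK. Qed.

Lemma decreasing_SOT (u : nat -> 'B(H)) :
  (forall k, effect (u k)) -> (forall k, u k.+1 <=o u k) ->
  exists Z, effect Z /\ SOT_cvg \oo u Z.
Proof.
move=> eu mu.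
have [k|k|Z [eZ uZ]] := @increasing_SOT _ \oo _ (fun k => 1 - u k).
- exact/effect_compl/eu.
- exists k => // j /= kj; apply/ope_le_compl; exact: ope_le_decr.
exists (1 - Z); split; first exact: effect_compl.
move=> x.
have -> : (fun k => u k x) = (fun k => x - (1 - u k) x).
  by apply/funext => k /=; rewrite subKr.
by apply: cvgB (uZ x); exact: cvg_cst.
Qed.

Lemma decreasing_SOT_le (u : nat -> 'B(H)) Z k :
  (forall k, u k.+1 <=o u k) -> SOT_cvg \oo u Z -> Z <=o u k.
Proof.
move=> mu uZ; apply: (WOT_ope_le (SOT_WOT uZ)).
by exists k => // j /= kj; exact: ope_le_decr.
Qed.

Lemma effect_sqr_le A : effect A -> A * A <=o A.
Proof.
move=> eA; apply/ope_leP => x /=.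
by rewrite (positive_sym (effect_ge0 eA)) -inner_norm effect_norm.
Qed.

Lemma effect_sqr A : effect A -> effect (A * A).
Proof.
move=> eA; split.
  apply/ope_le0 => x /=.
  by rewrite (positive_sym (effect_ge0 eA)) -inner_norm exprn_ge0.
apply/ope_leP => x; have /ope_leP/(_ x)/le_trans := effect_sqr_le eA; apply.
by case: eA => _ /ope_leP.
Qed.

Lemma effect_fixed B y : effect B -> inner y y <= inner (B y) y -> B y = y.
Proof.
move=> eB le; apply/eqP; rewrite eq_sym -subr_eq0; apply/eqP.
apply: (effect_eq0 (A := 1 - B) (effect_compl eB)).
apply/eqP; rewrite eq_le (effect_ge0 (effect_compl eB)) andbT /=.
by rewrite innerDl innerNl subr_le0.
Qed.

(** [P] is the strong limit of the successive squares [B, B^2, B^4, ...],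
    that is, the orthogonal projection onto the fixed space of [B]. Squaring is
    used because [A * A <= A] follows at once from [effect_norm]. *)
Lemma fixed_projection B : effect B ->
  exists P, [/\ effect P, P <=o B, forall x, B (P x) = P x
    & forall x, B x = x -> P x = x].
Proof.
move=> eB; pose u k := iter k (fun A => A * A) B.
have eu k : effect (u k) by elim: k => //= k; exact: effect_sqr.
have mu k : u k.+1 <=o u k by exact: effect_sqr_le.
have [P [eP uP]] := decreasing_SOT eu mu.
have Pu k : P <=o u k by exact: decreasing_SOT_le.
exists P; split=> //; first exact: Pu 0.
  move=> x; set y := P x.
  have qx : inner (P x) x <= inner y y.
    rewrite -inner_norm -subr_ge0.
    (* [|u k x|^2 = <u (k+1) x, x>], which dominates [<P x, x>] *)
    apply: (@cvg_ge0 _ \oo _ (fun k => `|u k x| ^+ 2 - inner (P x) x)).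
      apply: cvgB; last exact: cvg_cst.
      have nu : (`|u k x| : R[i]^o) @[k --> \oo] --> (`|y| : R[i]^o).
        by apply: cvg_norm; exact: uP.
      exact: (cvgM nu nu).
    near=> k; rewrite subr_ge0 inner_norm -(positive_sym (effect_ge0 (eu k))).
    exact: ope_leW (Pu k.+1).
  (* Positivity of [P] at [x - y] now yields [<y,y> <= <Py,y> <= <By,y>]. *)
  apply: effect_fixed => //.
  apply: (@le_trans _ _ (inner (P y) y)); last exact: ope_leW (Pu 0).
  have := effect_ge0 eP (x - y).
  rewrite !(opeD, opeN, innerDl, innerDr, innerNl, innerNr) -/y.
  rewrite (positive_sym (effect_ge0 eP) y x) -/y => h.
  move: qx; rewrite -subr_ge0 => /(addr_ge0 h) {}h; rewrite -subr_ge0.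
  apply: le_trans h _; rewrite le_eqVlt; apply/orP; left; apply/eqP.
  by rewrite -/y; ring.
move=> x Bx.
have ux k : u k x = x by elim: k => //= k IH; rewrite [LHS]/= IH.
have := uP x; under eq_fun do rewrite ux.
by move=> h; exact: norm_cvg_unique h (cvg_cst x).
Unshelve. all: by end_near. Qed.

Lemma closed_ker A : closed (ker A).
Proof.
apply: (@preimage_closed _ _ A [set 0]); last first.
  exact: (accessible_closed_set1 (hausdorff_accessible (@norm_hausdorff _ H))).
by move=> x _; exact: bop_continuous.
Qed.

Lemma closed_subspace_ker A : closed_subspace (ker A).
Proof.
split; [exact: (linear0 A)| |exact: closed_ker].
by move=> c x y; rewrite /ker /= opeD opeZ => -> ->; rewrite scaler0 addr0.
Qed.

(** The kernels of [Q] and [1 - Q] are the fixed spaces of [1 - Q] and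
    [Q], so both are ranges of projections [P0] and [P1]. The estimates
    [P0 <= 1 - Q] and [P1 <= Q] make these projections annihilate each other, and
    the common kernel of [P0] and [P1] is the remaining summand. *)
Lemma effect_decomposition Q : effect Q ->
  exists M, orthogonal_decomposition3 M (ker Q) (ker (1 - Q)).
Proof.
move=> eQ.
have [P1 [eP1 P1Q QP1 fix1]] := fixed_projection eQ.
have [P0 [eP0 P0Q QP0 fix0]] := fixed_projection (effect_compl eQ).
have ker0 x : Q x = 0 -> P0 x = x.
  by move=> Qx; apply: fix0; rewrite opeC Qx subr0.
have ker1 x : (1 - Q) x = 0 -> P1 x = x.
  by rewrite opeC => /eqP; rewrite subr_eq0 => /eqP/esym; exact: fix1.
have ran0 x : Q (P0 x) = 0.
  by have /eqP := QP0 x; rewrite opeC -[X in _ == X]subr0 => /eqP/addrI/oppr_inj.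
have ran1 x : (1 - Q) (P1 x) = 0 by rewrite opeC QP1 subrr.
have P01 x : P0 (P1 x) = 0.
  apply: effect_eq0 => //; apply/eqP.
  rewrite eq_le (effect_ge0 eP0) andbT -(linear0l (inner (s := H)) (P1 x)) -(ran1 x).
  exact: ope_leW.
have P10 x : P1 (P0 x) = 0.
  apply: effect_eq0 => //; apply/eqP.
  rewrite eq_le (effect_ge0 eP1) andbT -(linear0l (inner (s := H)) (P0 x)) -(ran0 x).
  exact: ope_leW.
have sym0 := positive_sym (effect_ge0 eP0).
have sym1 := positive_sym (effect_ge0 eP1).
exists (ker P0 `&` ker P1); split.
- split; [|exact: closed_subspace_ker..].
  have [z0 l0 c0] := closed_subspace_ker P0.
  have [z1 l1 c1] := closed_subspace_ker P1.
  split; [by split| |exact: closedI].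
  by move=> c x y [x0 x1] [y0 y1]; split; [exact: l0|exact: l1].
- split=> x y.
  + by move=> [x0 _] /ker0 <-; rewrite -sym0 x0 linear0l.
  + by move=> [_ x1] /ker1 <-; rewrite -sym1 x1 linear0l.
  + by move=> /ker0 <- /ker1 <-; rewrite sym0 P01 linear0r.
move=> x; exists (x - P0 x - P1 x), (P0 x), (P1 x); split.
- split; rewrite /ker /= !(opeD, opeN).
  + by rewrite (ker0 _ (ran0 x)) P01 subrr subr0.
  + by rewrite (ker1 _ (ran1 x)) P10 subr0 subrr.
- exact: ran0.
- exact: ran1.
- by rewrite [RHS]addrAC !subrK.
Qed.

(** * The map Phi on positive contractions *)

(** Either [adjoint A] has the defining property of an adjoint, or it is the
    default value [0] and both sides vanish. *)
Lemma adjoint_form A Y x :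
  inner ((A * Y * adjoint A) x) x = inner (Y (adjoint A x)) (adjoint A x).
Proof.
rewrite /= /adjoint; case: xgetP => [B _ AB|_] /=; first exact: AB.
by rewrite (linear0 Y) (linear0 A) !linear0l.
Qed.

End Operators.

#[local] Existing Instance totally_filter.

Section PhiTheory.
Context {R : realType} {H : hilbertType R} {n : nat}.
Variables (a : seq 'I_n -> R) (T : 'I_n -> 'B(H)).
Hypothesis a_ge0 : forall w, 0 <= a w.
Implicit Types (Y Z : 'B(H)) (F G : {fset seq 'I_n}) (x : H).

Lemma Phi_partial_form Y F x :
  inner (Phi_partial a T Y F x) x =
  \sum_(w <- F | (0 < size w)%N) (a w)%:C *
    inner (Y (adjoint (word_op T w) x)) (adjoint (word_op T w) x).
Proof.
rewrite /Phi_partial (big_morph (fun A : 'B(H) => inner (A x) x)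
  (id1 := 0) (op1 := +%R)) /=; last 2 first.
- by move=> A B /=; rewrite innerDl.
- by rewrite linear0l.
by apply: eq_bigr => w _; rewrite [LHS]innerZl adjoint_form.
Qed.

Lemma Phi_partial_mono Y Z F : Y <=o Z -> Phi_partial a T Y F <=o Phi_partial a T Z F.
Proof.
move=> YZ; apply/ope_leP => x; rewrite !Phi_partial_form.
apply: ler_sum => w _; apply: ler_wpM2l; first by rewrite lecR.
exact: ope_leW.
Qed.

Lemma Phi_partialB Y Z F :
  Phi_partial a T (Z - Y) F = Phi_partial a T Z F - Phi_partial a T Y F.
Proof.
rewrite /Phi_partial -sumrB; apply: eq_bigr => w _.
by rewrite -scalerBr mulrBr mulrBl.
Qed.

Lemma Phi_partial_sub Y F G :
  0 <=o Y -> (F `<=` G)%fset -> Phi_partial a T Y F <=o Phi_partial a T Y G.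
Proof.
move=> /ope_le0 Y0 FG; apply/ope_leP => x; rewrite !Phi_partial_form.
rewrite [leRHS](big_fsetIDcond _ (mem F)) /=.
have -> : [fset w | w in G & w \in F]%fset = F.
  apply/fsetP => w; rewrite !inE andbC; case wF : (w \in F) => //=.
  exact: (fsubsetP FG).
rewrite lerDl; apply: sumr_ge0 => w _; apply: mulr_ge0; first by rewrite lecR.
exact: Y0.
Qed.

(** For a positive argument the partial sums increase with the set of
    words, so each of them is below the limit. The difference [Z - Y] is used
    with [Y = 0] for [Q] and with [Z = 1] for [1 - Q]. *)
Lemma Phi_partial_le_lim Y Z VY VZ F :
  Phi_cvg a T Y VY -> Phi_cvg a T Z VZ -> Y <=o Z ->
  Phi_partial a T (Z - Y) F <=o VZ - VY.
Proof.
move=> cY cZ YZ; apply: (WOT_ope_ge (WOT_cvgB cZ cY)).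
exists F => // G FG; rewrite -Phi_partialB; apply: Phi_partial_sub => //.
exact/ope_le0.
Qed.

Lemma Phi_partial_gen Y i x :
  inner (Phi_partial a T Y [fset [:: i]]%fset x) x =
  (a [:: i])%:C * inner (Y (adjoint (T i) x)) (adjoint (T i) x).
Proof.
rewrite Phi_partial_form big_mkcond big_seq_fset1 /=.
by rewrite /word_op big_seq1.
Qed.

(** The single word [g_i] already bounds the whole series from below. *)
Lemma Phi_gen_le Y Z VY VZ i x :
  Phi_cvg a T Y VY -> Phi_cvg a T Z VZ -> Y <=o Z ->
  (a [:: i])%:C * inner ((Z - Y) (adjoint (T i) x)) (adjoint (T i) x) <=
  inner ((VZ - VY) x) x.
Proof.
move=> cY cZ YZ; rewrite -Phi_partial_gen; apply: ope_leW.
exact: Phi_partial_le_lim.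
Qed.

Lemma Phi_cvg0 : Phi_cvg a T 0 0.
Proof.
have E F : Phi_partial a T 0 F = 0.
  by apply: big1 => w _; rewrite mulr0 mul0r scaler0.
move=> x y; under eq_fun do rewrite E; exact: cvg_cst.
Qed.

Hypothesis Phi1 : exists Z, Phi_cvg a T 1 Z.
Hypothesis Phi1_le : Phi a T 1 <=o 1.

Lemma Phi1_cvg : Phi_cvg a T 1 (Phi a T 1).
Proof. exact: xgetPex. Qed.

Lemma effect_Phi_partial Y F : effect Y -> effect (Phi_partial a T Y F).
Proof.
move=> [Y0 Y1]; split.
  apply/ope_le0 => x; rewrite Phi_partial_form; apply: sumr_ge0 => w _.
  by apply: mulr_ge0; [rewrite lecR|move/ope_le0: Y0; exact].
apply: ope_le_trans (Phi_partial_mono F Y1) _.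
apply: ope_le_trans Phi1_le.
have := Phi_partial_le_lim F Phi_cvg0 Phi1_cvg; rewrite !subr0; apply.
exact: proj1 effect1.
Qed.

(** The partial sums at [Y] are dominated by those at [1], so they form an
    increasing net of positive contractions. *)
Lemma Phi_effect_cvg Y : effect Y -> Phi_cvg a T Y (Phi a T Y).
Proof.
move=> eY; apply: xgetPex.
have [|F|Z [_ ZP]] := @increasing_SOT _ _ _ totally _ (Phi_partial a T Y).
- by move=> F; exact: effect_Phi_partial.
- by exists F => // G; apply: Phi_partial_sub; case: eY.
by exists Z; exact: SOT_WOT.
Qed.

Lemma effect_Phi Y : effect Y -> effect (Phi a T Y).
Proof.
move=> eY; split.
  apply: WOT_ope_ge (Phi_effect_cvg eY) _.
  by apply: nearW => F; case: (effect_Phi_partial F eY).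
apply: WOT_ope_le (Phi_effect_cvg eY) _.
by apply: nearW => F; case: (effect_Phi_partial F eY).
Qed.

(** * The limit operator Q *)

Local Notation Qk k := (iter k (Phi a T) 1).

Lemma effect_Qk k : effect (Qk k).
Proof. by elim: k => [|k IH]; [exact: effect1|exact: effect_Phi]. Qed.

Lemma Phi_mono Y Z : effect Y -> effect Z -> Y <=o Z -> Phi a T Y <=o Phi a T Z.
Proof.
move=> eY eZ YZ; rewrite /ope_le.
have := Phi_partial_le_lim fset0 (Phi_effect_cvg eY) (Phi_effect_cvg eZ) YZ.
rewrite /Phi_partial big1_seq ?subr0; first by move/ope_le0.
by move=> w; rewrite inE andbF.
Qed.

Lemma Qk_decr k : Qk k.+1 <=o Qk k.
Proof.
by elim: k => [//|k IH]; apply: Phi_mono IH; exact: effect_Qk.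
Qed.

Lemma Qlim_SOT : effect (Qlim a T) /\ SOT_cvg \oo (fun k => Qk k) (Qlim a T).
Proof.
have [Z [eZ QZ]] := decreasing_SOT effect_Qk Qk_decr.
have Qc : SOT_cvg \oo (fun k => Qk k) (Qlim a T) by apply: xgetPex; exists Z.
suff -> : Qlim a T = Z by [].
by apply/val_inj/funext => x; exact: norm_cvg_unique (Qc x) (QZ x).
Qed.

Lemma effect_Qlim : effect (Qlim a T). Proof. by case: Qlim_SOT. Qed.

Lemma Qlim_cvg : SOT_cvg \oo (fun k => Qk k) (Qlim a T).
Proof. by case: Qlim_SOT. Qed.

(** Pass to the limit in
    [a_i <Q_k T_i^* x, T_i^* x> <= <Q_(k+1) x, x> <= <Q_k x, x>]. *)
Lemma Qlim_gen_le i x :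
  (a [:: i])%:C * inner (Qlim a T (adjoint (T i) x)) (adjoint (T i) x) <=
  inner (Qlim a T x) x.
Proof.
apply: (SOT_form_le Qlim_cvg Qlim_cvg) => k.
apply: le_trans (ope_leW x (Qk_decr k)).
have := Phi_gen_le i x Phi_cvg0 (Phi_effect_cvg (effect_Qk k)).
by rewrite !subr0; apply; case: (effect_Qk k).
Qed.

(** Pass to the limit on the left of
    [a_i <(1 - Q_k) T_i^* x, T_i^* x> <= <(Phi(1) - Q_(k+1)) x, x>], whose right
    side is at most [<(1 - Q) x, x>] because [Phi(1) <= 1] and [Q <= Q_(k+1)]. *)
Lemma Qlim_compl_gen_le i x :
  (a [:: i])%:C * inner ((1 - Qlim a T) (adjoint (T i) x)) (adjoint (T i) x) <=
  inner ((1 - Qlim a T) x) x.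
Proof.
apply: (@SOT_form_le _ _ _ (fun k => 1 - Qk k) (fun=> 1 - Qlim a T)).
- by move=> z; apply: cvgB; [exact: cvg_cst|exact: Qlim_cvg].
- by move=> z; exact: cvg_cst.
move=> k; have eQ := effect_Qk k.
have := Phi_gen_le i x (Phi_effect_cvg eQ) Phi1_cvg eQ.2.
move=> /le_trans; apply; apply: ope_leW.
apply: ope_le_trans (_ : 1 - Qk k.+1 <=o _).
  by rewrite /ope_le opprB addrA subrK.
apply/ope_le_compl; exact: decreasing_SOT_le Qk_decr Qlim_cvg.
Qed.

End PhiTheory.

Theorem theorem4p4 (R : realType) (H : hilbertType R) (n : nat) (hn : (1 <= n)%N)
    (a : seq 'I_n -> R) (ha : positive_regular a) (m : nat) (hm : (1 <= m)%N)
    (T : 'I_n -> 'B(H)) (hT : ncdomain a m T) :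
  [/\ exists M : set H,
        orthogonal_decomposition3 M (ker (Qlim a T)) (ker (1 - Qlim a T)),
      forall i : 'I_n, invariant_under (ker (Qlim a T)) (adjoint (T i))
    & forall i : 'I_n, invariant_under (ker (1 - Qlim a T)) (adjoint (T i))].
Proof.
have [[Z cZ] pos] := hT.
have [_ a0 _ ai] := ha.
have Phi1 : exists Z, Phi_cvg a T 1 Z by exists Z.
have Phi1_le : ope_le (Phi a T 1) 1 by apply: (pos 1); rewrite hm.
have eQ : effect (Qlim a T) := effect_Qlim a0 Phi1 Phi1_le.
split; first exact: effect_decomposition.
  move=> i x Qx; apply: (effect_form_ker eQ _ (Qlim_gen_le a0 Phi1 Phi1_le i x)) => //.
  by rewrite ltcR.
move=> i x Qx.
apply: (effect_form_ker (effect_compl eQ) _ (Qlim_compl_gen_le a0 Phi1 Phi1_le i x)) => //.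
by rewrite ltcR.
Qed.
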